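(* A field carrying an $\omega$-homogeneous pregeometry is algebraically closed.
   Context: An infinite model (structure) $M$ carries an $\omega$-homogeneous pregeometry if there is an invariant closure operator $\mathrm{cl}:\mathcal{P}(M)\to\mathcal{P}(M)$ (invariant under automorphisms of $M$) satisfying the axioms of a pregeometry, with $\dim(M)=\|M\|$, and such that whenever $A\subseteq M$ is finite and $a,b\notin\mathrm{cl}(A)$ there is an automorphism of $M$ preserving $\mathrm{cl}$, fixing $A$ pointwise, and sending $a$ to $b$. Here $M$ is the field. *)

(* Defs.v *)
From HB Require Import structures.
From mathcomp Require Import all_boot all_algebra.
From mathcomp Require Import boolp classical_sets functions cardinality.

Set Implicit Arguments.
Unset Strict Implicit.
Unset Printing Implicit Defensive.

Local Open Scope classical_set_scope.
Local Open Scope card_scope.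

Section Pregeometry.
Context {T : Type}.
Implicit Types (cl : set T -> set T) (A B : set T) (a b : T).

Record pregeometry cl : Prop := Pregeometry {
  pregeometry_ext : forall A, A `<=` cl A;
  pregeometry_mono : forall A B, A `<=` B -> cl A `<=` cl B;
  pregeometry_idem : forall A, cl (cl A) = cl A;
  pregeometry_fin : forall A a, cl A a ->
    exists B, [/\ finite_set B, B `<=` A & cl B a];
  pregeometry_exch : forall A a b,
    cl (A `|` [set b]) a -> ~ cl A a -> cl (A `|` [set a]) b }.

Definition cl_independent cl B : Prop :=
  forall b, B b -> ~ cl (B `\ b) b.

Definition cl_basis cl B : Prop :=
  cl_independent cl B /\ cl B = setT.

(* dim(T) = |C|; the choice of basis is immaterial, since any two bases of a
   pregeometry are equipotent. *)
Definition cl_dim_eq cl {U : Type} (C : set U) : Prop :=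
  exists B, cl_basis cl B /\ B #= C.

Definition preserves_cl cl (f : T -> T) : Prop :=
  forall A, cl (f @` A) = f @` cl A.

End Pregeometry.

Record omega_homogeneous_pregeometry (F : fieldType) (cl : set F -> set F) :
    Prop := OmegaHomogeneousPregeometry {
  ohp_pregeometry : pregeometry cl;
  ohp_invariant : forall f : {rmorphism F -> F},
    bijective f -> preserves_cl cl f;
  ohp_dim : cl_dim_eq cl [set: F];
  ohp_homogeneous : forall (A : set F) (a b : F),
    finite_set A -> ~ cl A a -> ~ cl A b ->
    exists f : {rmorphism F -> F},
      [/\ bijective f, preserves_cl cl f, forall x, A x -> f x = x & f a = b] }.

Definition carries_omega_homogeneous_pregeometry (F : fieldType) : Prop :=
  infinite_set [set: F] /\
  exists cl : set F -> set F, omega_homogeneous_pregeometry cl.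

(* Main.v *)
(** If [x] has a finite orbit under the automorphisms fixing a finite set [A],
    then [x] lies in [cl A], since the complement of [cl A] is infinite and forms
    a single orbit. Hence if an independent [n]-tuple and an [n]-tuple [c]
    determine each other up to finitely many choices, [c] is independent too.
    Two cases: the coefficients of the product of the [X - a_i], for independent
    [a_i], are independent; and if [P] is irreducible of degree [n] with root [z]
    and [t] is independent over the coefficients of [P], then the coefficients of
    the characteristic polynomial [C] of [b = t_0 + t_1 z + ... + t_(n-1) z^(n-1)]
    acting on [F(z)] are independent, because [b] determines [t] and is one of
    the finitely many roots of [C] in [F(z)]. All independent [n]-tuples being
    conjugate, [C] splits over [F], so [b] lies in [F]; for [n > 1] this forces
    [t_1 = 0]. *)

Require Import Defs.
From mathcomp Require Import all_boot all_algebra.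
From mathcomp Require Import boolp classical_sets functions cardinality.
From mathcomp Require Import fieldext.

Set Implicit Arguments.
Unset Strict Implicit.
Unset Printing Implicit Defensive.

Import GRing.Theory.
Local Open Scope classical_set_scope.
Local Open Scope ring_scope.

(** * Independence and exchange in a pregeometry *)

Section PregeometryDimension.
Context {T : eqType} (cl : set T -> set T).
Hypothesis clP : pregeometry cl.
Implicit Types (A B : set T) (s c : seq T).

(** Independence over [A] is tested entry by entry, in order, so that automorphisms can be built one
    entry at a time. *)
Fixpoint cl_free A s : Prop :=
  if s is x :: s' then ~ cl A x /\ cl_free (A `|` [set x]) s' else True.

Lemma cl_least A B : A `<=` cl B -> cl A `<=` cl B.
Proof. by move=> /(pregeometry_mono clP); rewrite (pregeometry_idem clP). Qed.

Lemma setU_seq_cat A c1 c2 :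
  A `|` [set` c1 ++ c2] = A `|` [set` c1] `|` [set` c2].
Proof.
rewrite predeqE => x; split=> /=.
  by rewrite mem_cat => -[?|/orP[?|?]]; [left; left|left; right|right].
move=> [[Ax|xc]|xc]; first by left.
  by right; rewrite mem_cat xc.
by right; rewrite mem_cat xc orbT.
Qed.

Lemma setU_seq_cons A x c : A `|` [set` x :: c] = A `|` [set x] `|` [set` c].
Proof.
rewrite -(cat1s x) setU_seq_cat; congr (_ `|` _ `|` _).
by rewrite predeqE => y /=; rewrite inE; split=> /eqP.
Qed.

Lemma setU_seq0 A : A `|` [set` [::]] = A.
Proof. by rewrite predeqE => x; split=> [[]//|]; left. Qed.

(** [y] ends the shortest prefix of [c] that captures [x] over [A], which is the configuration where
    exchange applies. *)
Lemma cl_split_first A c x : cl (A `|` [set` c]) x -> ~ cl A x ->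
  exists c1 y c2, [/\ c = c1 ++ y :: c2, ~ cl (A `|` [set` c1]) x
                    & cl (A `|` [set` c1] `|` [set y]) x].
Proof.
elim/last_ind: c => [|c y IH]; first by rewrite setU_seq0.
move=> clx nclx; have [h|h] := pselect (cl (A `|` [set` c]) x); last first.
  exists c, y, [::]; rewrite cats1; split=> //; move: clx.
  by rewrite -cats1 setU_seq_cat setU_seq_cons setU_seq0.
have [c1 [w [c2 [-> h1 h2]]]] := IH h nclx.
by exists c1, w, (rcons c2 y); rewrite rcons_cat.
Qed.

Lemma cl_free_size A s c :
  cl_free A s -> [set` s] `<=` cl (A `|` [set` c]) -> (size s <= size c)%N.
Proof.
elim: s A c => [//|x s IH] A c /= [nclx fs] sc.
(* Steinitz exchange: [x] replaces some [y] in [c]. *)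
have clx : cl (A `|` [set` c]) x by apply: sc; rewrite /= inE eqxx.
have [c1 [y [c2 [ec h1 h2]]]] := cl_split_first clx nclx.
have cly := pregeometry_exch clP h2 h1.
rewrite ec size_cat /= addnS ltnS -size_cat.
apply: IH fs _ => u us; have /sc : u \in x :: s by rewrite inE us orbT.
apply: cl_least => w; rewrite ec setU_seq_cat setU_seq_cons.
case=> [[wc1|->]|wc2].
- apply: (pregeometry_ext clP); rewrite setU_seq_cat.
  by left; case: wc1 => ?; [left; left|right].
- apply: (pregeometry_mono clP) cly => w' [[?|?]|->].
  + by left; left.
  + by rewrite setU_seq_cat; left; right.
  + by left; right.
- by apply: (pregeometry_ext clP); rewrite setU_seq_cat; right.
Qed.

Lemma not_cl_free A c : ~ cl_free A c ->
  exists c1 y c2, c = c1 ++ y :: c2 /\ cl (A `|` [set` c1]) y.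
Proof.
elim: c A => [|x c IH] A /=; first by case.
have [clx _|nclx] := pselect (cl A x).
  by exists [::], x, c; rewrite setU_seq0.
have [fc|/IH[c1 [y [c2 [-> cly]]]] _] := pselect (cl_free (A `|` [set x]) c).
  by case.
by exists (x :: c1), y, c2; rewrite setU_seq_cons.
Qed.

(** If an entry of [c] lay in the closure of [A] and the earlier ones, deleting it would leave a
    shorter sequence still spanning [s], against [cl_free_size]. *)
Lemma cl_free_exchange A s c : cl_free A s -> size s = size c ->
  [set` s] `<=` cl (A `|` [set` c]) -> cl_free A c.
Proof.
move=> fs ssc sc; apply: contrapT => /not_cl_free[c1 [y [c2 [ec cly]]]].
have : (size s <= size (c1 ++ c2))%N.
  apply: cl_free_size fs _ => u /sc; apply: cl_least => w.
  rewrite ec setU_seq_cat setU_seq_cons => -[[wc1|->]|wc2].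
  - by apply: (pregeometry_ext clP); rewrite setU_seq_cat; left.
  - by apply: (pregeometry_mono clP) cly; rewrite setU_seq_cat; left.
  - by apply: (pregeometry_ext clP); rewrite setU_seq_cat; right.
by rewrite ssc ec !size_cat /= addnS ltnn.
Qed.

Lemma cl_free_sub_independent A B s : cl_independent cl B -> A `<=` B ->
  [set` s] `<=` B -> uniq s -> (forall x, x \in s -> ~ A x) -> cl_free A s.
Proof.
move=> indB; elim: s A => [//|x s IH] A AB sB /= /andP[xs us] sA.
have xB : B x by apply: sB; rewrite /= inE eqxx.
split.
  move=> clx; apply: (indB x xB); apply: (pregeometry_mono clP) clx => y Ay.
  split; first exact: AB.
  by move=> /= eyx; apply: (sA x); rewrite ?inE ?eqxx // -eyx.
apply: IH => //.
- by move=> y [/AB//|->].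
- by move=> y ys; apply: sB; rewrite /= inE ys orbT.
- move=> y ys [Ay|/= eyx]; last by rewrite -eyx ys in xs.
  by apply: (sA y) => //; rewrite inE ys orbT.
Qed.

End PregeometryDimension.

(** * Closures of finite sets in infinite dimension *)

Section PregeometryInfinite.
Context {T : choiceType} (cl : set T -> set T).
Hypothesis clP : pregeometry cl.
Hypothesis Tinf : infinite_set [set: T].
Hypothesis Tdim : cl_dim_eq cl [set: T].

(** A finite set with full closure would bound the length of independent sequences, but a basis is
    infinite. *)
Lemma cl_finite_proper (A : set T) : finite_set A -> exists x, ~ cl A x.
Proof.
move=> /finite_seqP[c ->]; apply: contrapT => /forallNP clA.
have [B [[indB _] cardB]] := Tdim.
have Binf : infinite_set B by rewrite (eq_finite_set cardB).
have [X XB szX] := infinite_set_fset (size c).+1 Binf.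
have fX : cl_free cl set0 (finmap.enum_fset X).
  by apply: (cl_free_sub_independent clP indB) => // x _ [].
have : (size (finmap.enum_fset X) <= size c)%N.
  apply: (cl_free_size clP fX) => x _; rewrite set0U.
  exact: contrapT (clA x).
by rewrite leqNgt szX.
Qed.

Lemma cl_finite_compl_infinite (A : set T) :
  finite_set A -> infinite_set (~` cl A).
Proof.
move=> finA fincA.
(* With a finite complement adjoined, [A] would stay finite and have full closure. *)
have [|x] := @cl_finite_proper (A `|` ~` cl A); first by rewrite finite_setU.
have [clx|nclx] := pselect (cl A x).
  by apply; apply: (pregeometry_mono clP) clx; left.
by apply; apply: (pregeometry_ext clP); right.
Qed.

Lemma cl_free_exists (A : set T) n :
  finite_set A -> exists2 s, size s = n & cl_free cl A s.
Proof.
elim: n A => [|n IH] A finA; first by exists [::].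
have [x nx] := cl_finite_proper finA.
have [|s sz fs] := IH (A `|` [set x]).
  by rewrite finite_setU; split=> //; exact: finite_set1.
by exists (x :: s) => //=; rewrite sz.
Qed.

End PregeometryInfinite.

(** * Roots, coefficients and characteristic polynomials *)

Section Polynomials.

Lemma finite_roots (R : idomainType) (p : {poly R}) :
  p != 0 -> finite_set [set x | root p x].
Proof.
move=> p0; apply: contrapT => /infinite_set_fset => /(_ (size p))[X Xp].
rewrite leqNgt => /negP; apply; apply: max_poly_roots => //.
  by apply/allP => x; exact: Xp.
exact: finmap.fset_uniq.
Qed.

(** The leading coefficient is left out: for [p] monic of degree [n] it is 1, and these [n] entries
    determine [p]. *)
Definition low_coefs (R : nzRingType) n (p : {poly R}) : seq R :=
  mkseq (fun i => p`_i) n.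

Lemma map_poly_low_coefs (R R' : nzRingType) (f : {rmorphism R -> R'}) n
    (p : {poly R}) (q : {poly R'}) :
  p \is monic -> q \is monic -> size p = n.+1 -> size q = n.+1 ->
  map f (low_coefs n p) = low_coefs n q -> map_poly f p = q.
Proof.
move=> mp mq sp sq eqf; apply/polyP => i; rewrite coef_map.
case: (ltngtP i n) => [ltin|ltni|->].
- have := congr1 (nth 0 ^~ i) eqf.
  by rewrite /= (nth_map 0) ?size_mkseq // !nth_mkseq.
- by rewrite [p`_i]nth_default ?sp // [q`_i]nth_default ?sq // raddf0.
- have pn : p`_n = 1 by have /= := monicP mp; rewrite lead_coefE sp.
  have qn : q`_n = 1 by have /= := monicP mq; rewrite lead_coefE sq.
  by rewrite pn qn; exact: rmorph1.
Qed.

Lemma horner_mx_eigen (F : fieldType) n (A : 'M[F]_n.+1) (v : 'rV_n.+1) a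
    (p : {poly F}) : v *m A = a *: v -> v *m horner_mx A p = p.[a] *: v.
Proof.
move=> vA; elim/poly_ind: p => [|p c IH].
  by rewrite rmorph0 mulmx0 horner0 scale0r.
rewrite rmorphD rmorphM /= horner_mx_X horner_mx_C mulmxDr mulmxA IH.
by rewrite -scalemxAl vA mul_mx_scalar scalerA !hornerE scalerDl.
Qed.

(** An eigenvector of [A] for [a] is also one of [p(A)] for [p(a)]. *)
Lemma root_char_poly_horner_mx (F : fieldType) n (A : 'M[F]_n.+1) a p :
  root (char_poly A) a -> root (char_poly (horner_mx A p)) p.[a].
Proof.
rewrite -!eigenvalue_root_char => /eigenvalueP[v vA v0].
by apply/eigenvalueP; exists v => //; exact: horner_mx_eigen.
Qed.

(** The gcd of [p] and [g] vanishes at [z], hence is associate to [p] and too large to divide a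
    nonzero [g]. *)
Lemma irreducible_root_small (F L : fieldType) (f : {rmorphism F -> L})
    (p g : {poly F}) z :
  irreducible_poly p -> root (map_poly f p) z -> root (map_poly f g) z ->
  (size g < size p)%N -> g = 0.
Proof.
move=> [sp irr] pz gz sg; apply/eqP; apply: contraT => g0.
have rz : root (map_poly f (gcdp p g)) z.
  by rewrite gcdp_map root_gcd pz.
have nc : size (gcdp p g) != 1%N.
  apply/eqP => /eqP/size_poly1P[c c0 ec]; move: rz.
  by rewrite ec map_polyC rootC fmorph_eq0 (negPf c0).
have /eqp_size sz := irr _ nc (dvdp_gcdl _ _).
have := dvdp_leq g0 (dvdp_gcdr p g).
by rewrite sz leqNgt sg.
Qed.

Lemma monic_char_poly (R : comNzRingType) n (p : {poly R}) :
  p \is monic -> size p = n.+1 -> exists M : 'M[R]_n, char_poly M = p.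
Proof.
(* The companion matrix is generalized first, since its dimension [(size p).-1] has to become
   [n]. *)
move=> mp sp; have := companionmxK mp; move: (companionmx p).
by rewrite sp /= => M eM; exists M.
Qed.

End Polynomials.

(** * Automorphisms and independent tuples of the field *)

Section Homogeneous.
Context (F : fieldType) (cl : set F -> set F).
Hypothesis Finf : infinite_set [set: F].
Hypothesis hcl : omega_homogeneous_pregeometry cl.
Let clP := ohp_pregeometry hcl.

Lemma cl_finite_orbit (A S : set F) x : finite_set A -> finite_set S ->
  (forall f : {rmorphism F -> F}, (forall y, A y -> f y = y) -> S (f x)) ->
  cl A x.
Proof.
move=> finA finS orb; apply: contrapT => nx.
apply: (cl_finite_compl_infinite clP Finf (ohp_dim hcl) finA).
apply: sub_finite_set finS => y ny.
by have [f [_ _ fA <-]] := ohp_homogeneous hcl finA nx ny; exact: orb.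
Qed.

Lemma cl_free_neq0 (A : set F) s : finite_set A -> cl_free cl A s -> 0 \notin s.
Proof.
elim: s A => [//|x s IH] A finA /= [nx fs]; rewrite inE negb_or.
rewrite (IH _ _ fs) ?finite_setU ?andbT; last by split=> //; exact: finite_set1.
apply/eqP => x0; apply: nx; rewrite -x0.
apply: (cl_finite_orbit finA (finite_set1 0)) => f _ /=.
exact: rmorph0.
Qed.

Lemma cl_free_image (f : F -> F) (A : set F) s : injective f ->
  preserves_cl cl f -> cl_free cl A s -> cl_free cl (f @` A) (map f s).
Proof.
move=> finj fcl; elim: s A => [//|x s IH] A /= [nx fs]; split.
  by rewrite fcl => -[y cly /finj eyx]; apply: nx; rewrite -eyx.
by have := IH _ fs; rewrite image_setU image_set1.
Qed.

Lemma cl_free_conjugate (A : set F) s c : finite_set A -> size s = size c ->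
  cl_free cl A s -> cl_free cl A c ->
  exists f : {rmorphism F -> F}, map f s = c.
Proof.
(* Fixing [A] pointwise is needed for the induction: [g], built over [A] and [y], must keep
   [f x = y]. *)
suff gen : finite_set A -> size s = size c ->
    cl_free cl A s -> cl_free cl A c ->
    exists2 f : {rmorphism F -> F}, (forall x, A x -> f x = x) & map f s = c.
  by move=> ? ? ? ?; case: gen => // f _ <-; exists f.
elim: c s A => [|y c IH] [|x s] A //= finA; first by exists idfun.
case=> szs [nx fs] [ny fc].
have [f [fbij fcl fA fx]] := ohp_homogeneous hcl finA nx ny.
have imA : f @` (A `|` [set x]) = A `|` [set y].
  rewrite image_setU image_set1 fx; congr (_ `|` _).
  rewrite predeqE => w; split=> [[u Au <-]|Aw]; first by rewrite fA.
  by exists w => //; exact: fA.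
have := cl_free_image (bij_inj fbij) fcl fs; rewrite imA => fs'.
have finAy : finite_set (A `|` [set y]).
  by rewrite finite_setU; split=> //; exact: finite_set1.
have szs' : size (map f s) = size c by rewrite size_map.
have [g gA gs] := IH _ _ finAy szs' fs' fc.
exists (g \o f).
  by move=> w Aw /=; rewrite fA // gA //; left.
by rewrite map_comp gs /= fx gA //; right.
Qed.

(** A morphism fixing the coefficients sends each root to one of finitely many roots, so the
    coefficients span [s]. *)
Lemma cl_free_roots_coefs (A : set F) s : finite_set A -> cl_free cl A s ->
  cl_free cl A (low_coefs (size s) (\prod_(a <- s) ('X - a%:P))).
Proof.
move=> finA fs; set p := \prod_(a <- s) _.
apply: (cl_free_exchange clP fs); first by rewrite size_mkseq.
move=> x xs; apply: (@cl_finite_orbit _ [set y | root p y]).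
- by rewrite finite_setU; split=> //; exact: finite_seq.
- by apply: finite_roots; rewrite monic_neq0 // monic_prod_XsubC.
- move=> f ffix /=; suff <- : map_poly f p = p.
    by rewrite fmorph_root root_prod_XsubC.
  apply: (@map_poly_low_coefs _ _ _ (size s));
    rewrite ?monic_prod_XsubC ?size_prod_XsubC //.
  by apply: map_id_in => y ys; apply: ffix; right.
Qed.

(** * Generic elements of a simple extension *)

Section IrreducibleCharPoly.
Context (n : nat) (M : 'M[F]_n.+1).
Hypothesis irrM : irreducible_poly (char_poly M).

(** Morphisms fixing this finite set fix [M], which plays the role of multiplication by a root [z]
    of [char_poly M]. *)
Let entries : set F := [set` codom (fun ij : 'I_n.+1 * 'I_n.+1 => M ij.1 ij.2)].

Lemma cl_free_char_poly_coefs s : size s = n.+1 -> cl_free cl entries s ->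
  cl_free cl entries (low_coefs n.+1 (char_poly (horner_mx M (Poly s)))).
Proof.
move=> szs fs; set C := char_poly _.
have [L _ [z rz _]] := irredp_FAdjoin irrM.
(* [ev u] is the element of [L] with coordinates [u] on the powers of [z] up to [n]. *)
pose ev (u : n.+1.-tuple F) : L := (map_poly (in_alg L) (Poly u)).[z].
have ev_inj : injective ev.
  move=> u v euv; apply: val_inj; have uv0 : Poly u - Poly v = 0.
    apply: (irreducible_root_small irrM rz).
      by rewrite rmorphB rootE !hornerE -/(ev u) -/(ev v) euv subrr.
    rewrite size_char_poly ltnS (leq_trans (size_polyD _ _)) //.
    by rewrite geq_max size_polyN !(leq_trans (size_Poly _)) ?size_tuple.
  apply: (@eq_from_nth _ 0) => [|i _]; first by rewrite !size_tuple.
  by rewrite -(coef_Poly u) -(coef_Poly v) (subr0_eq uv0).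
pose U := ev @^-1` [set y | root (map_poly (in_alg L) C) y].
have finU : finite_set U.
  apply: finite_preimage; first by move=> ? ? _ _; exact: ev_inj.
  by apply: finite_roots; rewrite map_poly_eq0 monic_neq0 // char_poly_monic.
apply: (cl_free_exchange clP fs); first by rewrite size_mkseq.
move=> _ /(nthP 0)[i ltis <-].
apply: (@cl_finite_orbit _ [set nth 0 (val u) i | u in U]).
- by rewrite finite_setU; split; exact: finite_seq.
- exact: finite_image.
- move=> f ffix; have szfs : size (map f s) == n.+1 by rewrite size_map szs.
  exists (Tuple szfs); last by rewrite /= (nth_map 0).
  have fM : map_mx f M = M.
    apply/matrixP => j k; rewrite mxE; apply: ffix; left.
    exact: (codom_f (fun ij => M ij.1 ij.2) (j, k)).
  (* [f] carries [C] to the characteristic polynomial attached to [map f s], yet fixes the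
     coefficients of [C]. *)
  have fC : char_poly (horner_mx M (Poly (map f s))) = C.
    rewrite -[RHS](@map_poly_low_coefs _ _ f n.+1 C) ?size_char_poly
            ?char_poly_monic //; last first.
      by apply: map_id_in => y ys; apply: ffix; right.
    rewrite map_char_poly map_horner_mx fM; congr (char_poly (horner_mx _ _)).
    apply/polyP => j; rewrite coef_map !coef_Poly.
    have [ltjs|lesj] := ltnP j (size s); first by rewrite (nth_map 0).
    by rewrite !nth_default ?size_map // raddf0.
  rewrite /U /= -fC map_char_poly map_horner_mx.
  by apply: root_char_poly_horner_mx; rewrite -map_char_poly.
Qed.

Lemma irreducible_char_poly_dim1 : n = 0%N.
Proof.
apply/eqP; rewrite -leqn0 leqNgt; apply/negP => n_gt0.
have finE : finite_set entries by exact: finite_seq.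
have [s szs fs] := cl_free_exists clP Finf (ohp_dim hcl) n.+1 finE.
have fC := cl_free_char_poly_coefs szs fs.
set C := char_poly _ in fC.
have fR := cl_free_roots_coefs finE fs.
have [|f fRC] := cl_free_conjugate finE _ fR fC.
  by rewrite !size_mkseq.
(* [f] maps the split polynomial with roots [s] to [C]. *)
have : C = \prod_(a <- map f s) ('X - a%:P).
  rewrite szs in fRC.
  rewrite -(map_poly_low_coefs _ _ _ _ fRC) ?monic_prod_XsubC
    ?size_prod_XsubC ?char_poly_monic ?size_char_poly ?szs //.
  rewrite rmorph_prod big_map; apply: eq_bigr => a _.
  by rewrite /= map_polyXsubC.
move=> eC.
have [L _ [z rz _]] := irredp_FAdjoin irrM.
have : root (map_poly (in_alg L) C) (map_poly (in_alg L) (Poly s)).[z].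
  rewrite map_char_poly map_horner_mx.
  by apply: root_char_poly_horner_mx; rewrite -map_char_poly.
(* All roots of [C] in [L] come from [F], so the value of [Poly s] at [z] is some [b] in [F]. *)
rewrite eC rmorph_prod.
under eq_bigr do rewrite /= map_polyXsubC.
rewrite -(big_map (in_alg L) xpredT (fun a => 'X - a%:P)) root_prod_XsubC.
move=> /mapP[b _ eb].
have g0 : Poly s - b%:P = 0.
  apply: (irreducible_root_small irrM rz).
    by rewrite rmorphB rootE !hornerE /= eb map_polyC hornerC subrr.
  rewrite size_char_poly ltnS (leq_trans (size_polyD _ _)) //.
  rewrite geq_max size_polyN (leq_trans (size_Poly _)) ?szs //.
  by rewrite (leq_trans (size_polyC_leq1 _)).
have /negP := cl_free_neq0 finE fs; apply.
(* As [n > 0], index 1 is a true entry of [s], not the default 0. *)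
have s1 : s`_1 = 0 by rewrite -coef_Poly (subr0_eq g0) coefC.
by rewrite -s1 mem_nth // szs.
Qed.

End IrreducibleCharPoly.

(** * From irreducible polynomials to algebraic closure *)

Lemma irreducible_poly_size2 (p : {poly F}) : irreducible_poly p -> size p = 2%N.
Proof.
move=> [sp irr]; have p0 : p != 0 by rewrite -size_poly_gt0 ltnW.
have l0 : (lead_coef p)^-1 != 0 by rewrite invr_eq0 lead_coef_eq0.
set q := (lead_coef p)^-1 *: p; have sq : size q = size p by rewrite size_scale.
have mq : q \is monic by rewrite monicE lead_coefZ mulVf // lead_coef_eq0.
have irrq : irreducible_poly q.
  split=> [|r sr]; first by rewrite sq.
  by rewrite dvdpZr // (eqp_rtrans (eqp_scale _ l0)); exact: irr.
have [n sn] : exists n, size p = n.+2 by case: (size p) sp => [|[|n]] //; exists n.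
rewrite sn in sq; have [M eM] := monic_char_poly mq sq.
by rewrite -eM in irrq; rewrite sn (irreducible_char_poly_dim1 irrq).
Qed.

Lemma nonconstant_has_root (p : {poly F}) : (1 < size p)%N -> exists x, root p x.
Proof.
have [n] := ubnP (size p); elim: n p => // n IH p; rewrite ltnS => spn sp.
have [irr|nirr] := pselect (irreducible_poly p).
  by have [x] := poly2_root (irreducible_poly_size2 irr); exists x.
(* A reducible [p] has a nonconstant divisor of smaller degree, whose root is a root of [p]. *)
have [q [sq qp nqp]] :
    exists q : {poly F}, [/\ size q != 1%N, q %| p & ~~ (q %= p)].
  apply: contrapT => nq; apply: nirr; split=> // q sq qp.
  by apply: contrapT => /negP nqp; apply: nq; exists q.
have p0 : p != 0 by rewrite -size_poly_gt0 ltnW.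
have q0 : q != 0 by apply: dvdpN0 qp p0.
have ltqp : (size q < size p)%N.
  by rewrite ltn_neqAle dvdp_size_eqp // nqp dvdp_leq.
have [||x qx] := IH q.
- exact: leq_trans ltqp spn.
- by rewrite ltn_neqAle eq_sym sq size_poly_gt0.
by exists x; exact: root_dvdp qp qx.
Qed.

End Homogeneous.

Theorem theorem2p13 (F : fieldType)
  (hF : carries_omega_homogeneous_pregeometry F) :
  GRing.closed_field_axiom F.
Proof.
have [Finf [cl hcl]] := hF; move=> n P n_gt0.
(* The equation to solve says that [x] is a root of ['X^n - r], nonconstant because [r] has degree
   below [n]. *)
pose r := \poly_(i < n) P i; have sr : (size r < size ('X^n : {poly F}))%N.
  by rewrite size_polyXn ltnS size_poly.
have [|x] := @nonconstant_has_root _ _ Finf hcl ('X^n - r).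
  by rewrite size_polyDl ?size_polyN // size_polyXn ltnS.
rewrite rootE !hornerE subr_eq0 => /eqP xn; exists x.
by rewrite xn horner_poly.
Qed.
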